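(* Let $k\ge 0$ be an integer and $n=2^k$. Consider the RBO protocol with broadcast cycle of length $n$, arbitrary real keys $\kappa_0\le\kappa_1\le\dots\le\kappa_{n-1}$, an arbitrary query interval $[\kappa',\kappa'']$ with $-\infty<\kappa'\le\kappa''<+\infty$, and an arbitrary starting time slot $s\in\{0,\dots,n-1\}$ of the receiver. Then the extra energy of the RBO receiver is at most $2k+3$.
   Context: For an integer $x$, $\mathrm{bin}_k(x)$ denotes the length-$k$ binary string (most significant bit first) representing $x \bmod 2^k$, and $\mathrm{rev}_k(x)$ denotes the integer in $\{0,\dots,2^k-1\}$ whose $k$-bit binary representation is the reversal of $\mathrm{bin}_k(x)$. RBO protocol: at every time slot $t=0,1,2,\dots$ the broadcaster transmits the key $\kappa_{\mathrm{rev}_k(t)}$. The receiver, requesting keys in $[\kappa',\kappa'']$, starts at time slot $s$ with integer variables $\mathrm{lb}=0$ and $\mathrm{ub}=n-1$, and at each time slot $t\ge s$: if $\mathrm{lb}\le \mathrm{rev}_k(t)\le \mathrm{ub}$, it receives $\kappa=\kappa_{\mathrm{rev}_k(t)}$ and, if $\kappa<\kappa'$, sets $\mathrm{lb}:=\mathrm{rev}_k(t)+1$, and if $\kappa''<\kappa$, sets $\mathrm{ub}:=\mathrm{rev}_k(t)-1$ (otherwise the variables are unchanged). The left-side energy is the number of changes of the variable $\mathrm{lb}$, the right-side energy is the number of changes of the variable $\mathrm{ub}$, and the extra energy is the sum of the left-side and right-side energies. *)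

(* Defs.v *)
From HB Require Import structures.
From mathcomp Require Import all_boot all_order all_algebra.
From mathcomp Require Import classical_sets reals constructive_ereal.
From mathcomp Require Import counting_measure.

Set Implicit Arguments.
Unset Strict Implicit.
Unset Printing Implicit Defensive.

Import Order.TTheory GRing.Theory Num.Theory.

Local Open Scope classical_set_scope.
Local Open Scope ring_scope.

(* Strings are written most significant bit first: position [i] of a
   length-[k] string has weight [2 ^ (k - 1 - i)]. *)
Definition bin (k : nat) (x : int) : k.-tuple bool :=
  [tuple odd (`|(x %% (2 ^ k)%:Z)%Z| %/ 2 ^ (k - i.+1))%N | i < k].

Definition bits_val (s : seq bool) : nat :=
  foldl (fun (v : nat) (b : bool) => (v.*2 + b)%N) 0%N s.

Lemma bits_val_rcons s b : bits_val (rcons s b) = ((bits_val s).*2 + b)%N.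
Proof. by rewrite /bits_val foldl_rcons. Qed.

Lemma bits_val_lt s : (bits_val s < 2 ^ size s)%N.
Proof.
elim/last_ind: s => [//|s b IH].
rewrite bits_val_rcons size_rcons expnS mul2n.
apply: (@leq_trans (bits_val s).+1.*2); last by rewrite leq_double.
by rewrite doubleS !ltnS -addn1 leq_add2l leq_b1.
Qed.

Lemma bit_rev_subproof (k : nat) (x : int) :
  (bits_val (rev (bin k x)) < 2 ^ k)%N.
Proof. by have := bits_val_lt (rev (bin k x)); rewrite size_rev size_tuple. Qed.

Definition bit_rev (k : nat) (x : int) : 'I_(2 ^ k) :=
  Ordinal (bit_rev_subproof k x).

Lemma binE k x : bin k x =
  mkseq (fun i => odd (`|(x %% (2 ^ k)%:Z)%Z| %/ 2 ^ (k - i.+1))%N) k :> seq bool.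
Proof. by rewrite /mkseq -val_enum_ord -map_comp. Qed.

Lemma mkseq_oddS k m :
  mkseq (fun i => odd (m %/ 2 ^ (k.+1 - i.+1))) k.+1 =
  rcons (mkseq (fun i => odd (m./2 %/ 2 ^ (k - i.+1))) k) (odd m).
Proof.
rewrite mkseqS subnn expn0 divn1; congr rcons.
apply/eq_in_map => i; rewrite mem_iota /= add0n => ltik.
by rewrite subSS -divn2 -divnMA -expnS subnSK.
Qed.

Lemma bits_val_mkseq k m : (m < 2 ^ k)%N ->
  bits_val (mkseq (fun i => odd (m %/ 2 ^ (k - i.+1))) k) = m.
Proof.
elim: k m => [|k IH] m; first by case: m.
rewrite expnS mul2n => ltm.
rewrite mkseq_oddS bits_val_rcons IH; first by rewrite addnC odd_double_half.
rewrite -ltn_double (leq_ltn_trans _ ltm)//.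
by rewrite -[leqRHS]odd_double_half leq_addl.
Qed.

Lemma mkseq_bits_val s :
  mkseq (fun i => odd (bits_val s %/ 2 ^ (size s - i.+1))) (size s) = s.
Proof.
elim/last_ind: s => [//|s b IH].
rewrite size_rcons mkseq_oddS bits_val_rcons addnC half_bit_double IH.
by rewrite oddD odd_double addbF oddb.
Qed.

Lemma bits_val_bin (k : nat) (x : int) :
  (bits_val (bin k x))%:Z = (x %% (2 ^ k)%:Z)%Z.
Proof.
have n0 : (2 ^ k)%:Z != 0 by rewrite eqz_nat expn_eq0.
rewrite binE bits_val_mkseq ?gez0_abs ?modz_ge0// -ltz_nat gez0_abs ?modz_ge0//.
by rewrite ltz_pmod// ltz_nat expn_gt0.
Qed.

Lemma bin_bit_rev (k : nat) (x : int) :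
  bin k (bit_rev k x)%:Z = rev (bin k x) :> seq bool.
Proof.
rewrite binE modz_small ?ler0n ?ltz_nat ?ltn_ord//=.
by have := mkseq_bits_val (rev (bin k x)); rewrite size_rev size_tuple.
Qed.

(* [ub] may become [-1] and [lb] may become [2 ^ k], hence integers. *)
Record receiver := Receiver { lb : int; ub : int }.

Section RBO.
Variables (R : realType) (k : nat) (key : 'I_(2 ^ k) -> R).

Definition broadcast (t : nat) : R := key (bit_rev k t%:Z).

Variables (kmin kmax : R).

Definition receive (t : nat) (v : receiver) : receiver :=
  let r : int := (bit_rev k t%:Z : nat)%:Z in
  if lb v <= r <= ub v then
    Receiver (if broadcast t < kmin then r + 1 else lb v)
             (if kmax < broadcast t then r - 1 else ub v)
  else v.

Variable s : nat.

(* State after the [j] time slots [s], ..., [s + j - 1]. *)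
Fixpoint run (j : nat) : receiver :=
  if j is j'.+1 then receive (s + j') (run j')
  else Receiver 0 ((2 ^ k)%:Z - 1).

(* The receiver is never stopped, so changes are counted over all time slots
   [s + j], [j : nat]; [counting] is [+oo] on infinite sets. *)
Definition left_energy : \bar R :=
  counting [set j : nat | lb (run j.+1) <> lb (run j)].

Definition right_energy : \bar R :=
  counting [set j : nat | ub (run j.+1) <> ub (run j)].

Definition extra_energy : \bar R := (left_energy + right_energy)%E.

End RBO.

(* Main.v *)
Require Import Defs.
From mathcomp Require Import all_boot all_order all_algebra.
From mathcomp Require Import reals constructive_ereal.
From mathcomp Require Import finmap boolp classical_sets cardinality.
From mathcomp Require Import counting_measure.
From mathcomp Require Import zify.

(** Let [q x] be the slot, counted from [s], at which the value [x] is first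
    broadcast.  If [a] is the number of keys below [kmin], then [lb] changes
    exactly at the times [q x] for the [x < a] such that [q x < q y] whenever
    [x < y < a], that is at the running minima of [q (a - 1), ..., q 0].
    The pair [q (2 c)], [q (2 c + 1)] is [p c], [p c + n / 2] in some order,
    where [p] is of the same kind as [q] for [k - 1] bits.  Scanning downwards,
    the minimum is below [n / 2] as soon as a full pair has been passed, and
    from then on the running minima are those of [p]; in the end [q] has at
    most one running minimum more than [p] restricted to a suitable initial
    segment, so there are at most [k + 1] of them.  Complementing the bits of the values
    preserves this pairing and exchanges the roles of [lb] and [ub], hence
    the bound [k + 1] on either side. *)

Set Implicit Arguments.
Unset Strict Implicit.
Unset Printing Implicit Defensive.

Import Order.TTheory GRing.Theory Num.Theory.

(** * Running minima of sequences with a binary pairing structure *)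

Section Minima.
Local Open Scope nat_scope.

(* The successive minima below [th] of [q (a - 1), ..., q 0]. *)
Fixpoint minima (q : nat -> nat) (a th : nat) : seq nat :=
  if a is a'.+1 then
    if q a' < th then q a' :: minima q a' (q a') else minima q a' th
  else [::].

Lemma mem_minima (q : nat -> nat) (a th x : nat) :
  x < a -> q x < th -> (forall y, x < y < a -> q x < q y) ->
  q x \in minima q a th.
Proof.
elim: a th => [//|a IH] th; rewrite ltnS leq_eqVlt => /predU1P[->|ltxa] qx xmin /=.
  by rewrite qx inE eqxx.
have ltq : q x < q a by apply: xmin; rewrite ltxa /=.
have xmin' y : x < y < a -> q x < q y.
  by move=> /andP[ltxy ltya]; apply: xmin; rewrite ltxy ltnW.
by case: ifP => _; [rewrite inE IH ?orbT | exact: IH].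
Qed.

(** The lowest bit of the argument governs the highest bit of the value. That [b] may vary with [c]
    leaves room for the carries of a shift modulo [2 ^ k]. *)
Fixpoint digital (k : nat) (q : nat -> nat) : Prop :=
  if k is k'.+1 then
    exists2 p, digital k' p &
      forall c, c < 2 ^ k' -> exists b : bool,
        q c.*2 = p c + b * 2 ^ k' /\ q c.*2.+1 = p c + ~~ b * 2 ^ k'
  else q 0 = 0.

Lemma digital_lt k q x : digital k q -> x < 2 ^ k -> q x < 2 ^ k.
Proof.
elim: k q x => [|k IH] q x /=.
  by move=> q0; case: x => // _; rewrite q0.
move=> [p dp qp]; rewrite expnS -{1}[x]odd_double_half => ltx.
have ltc : x./2 < 2 ^ k by lia.
have [b [q0 q1]] := qp _ ltc; have := IH _ _ dp ltc.
rewrite -[x in q x]odd_double_half.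
by case: (odd x); rewrite ?add1n ?add0n ?q0 ?q1; case: b {q0 q1} => /=; lia.
Qed.

Lemma digital_opp k q : digital k q -> digital k (fun x => q (2 ^ k - x.+1)).
Proof.
elim: k q => [|k IH] q //= [p dp qp].
exists (fun c => p (2 ^ k - c.+1)); first exact: IH.
move=> c ltc; have [|b [q0 q1]] := qp (2 ^ k - c.+1); first lia.
exists (~~ b); rewrite negbK -q0 -q1 expnS; split; congr q; lia.
Qed.

Definition twofold (h : nat) (p q : nat -> nat) :=
  forall c, c < h -> p c < h /\ exists b : bool,
    q c.*2 = p c + b * h /\ q c.*2.+1 = p c + ~~ b * h.

(** Under a threshold of at most [h], the upper member of a pair is never a minimum, and the lower
    one equals [p c]. *)
Lemma minima_double h p q a th :
  twofold h p q -> a <= h -> th <= h -> minima q a.*2 th = minima p a th.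
Proof.
move=> qp; elim: a th => [//|a IH] th lta leth; rewrite doubleS /=.
have [ltp [b [-> ->]]] := qp a lta.
case: b; rewrite ?mul1n ?mul0n ?addn0.
  have F x : x <= h -> (p a + h < x) = false by lia.
  by case: (ltnP (p a) th) => _; rewrite F ?IH // ltnW.
have -> : (p a + h < th) = false by lia.
by case: (ltnP (p a) th) => _; rewrite IH // ltnW.
Qed.

Lemma size_minima_half h p q m a :
  twofold h p q -> a <= h.*2 ->
  (forall c, c <= h -> size (minima p c h) <= m) ->
  size (minima q a h.*2) <= m.+1.
Proof.
move=> qp; rewrite -[in a <= _](odd_double_half a) -[in minima _ a](odd_double_half a).
move: (odd a) a./2 => e c {a}.
have dbl c' th : c' <= h -> th <= h -> minima q c'.*2 th = minima p c' th.
  exact: minima_double.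
(* Over whole pairs the only possible extra minimum is the upper member of the first pair, when it
   is scanned first. *)
have even c' : c' < h -> size (minima q c'.+1.*2 h.*2) <= (size (minima p c'.+1 h)).+1.
  move=> ltc; rewrite doubleS /=; have [ltp [b [-> ->]]] := qp c' ltc.
  rewrite ltp; case: b; rewrite ?mul1n ?mul0n ?addn0.
    have -> : p c' < h.*2 by lia.
    have -> : (p c' + h < p c') = false by lia.
    by rewrite /= dbl // ltnW.
  have -> : p c' + h < h.*2 by lia.
  have -> : p c' < p c' + h by lia.
  by rewrite /= dbl // ltnW.
case: e => /=; last first.
  rewrite add0n; case: c => [//|c] ltc bnd.
  by apply: (leq_trans (even c _)); [lia | rewrite ltnS bnd //; lia].
rewrite add1n /= => ltc bnd; have {}ltc : c < h by lia.
have [ltp [b [-> _]]] := qp c ltc.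
have bndS := bnd _ ltc; rewrite /= ltp in bndS.
(* The scan starts inside a pair. If the lone value is below [h], then [p] governs from here on;
   otherwise the next pair, if any, decides. *)
case: b; rewrite ?mul1n ?mul0n ?addn0; last first.
  have -> : p c < h.*2 by lia.
  by rewrite /= dbl; [exact: leqW | exact: ltnW ..].
have -> : p c + h < h.*2 by lia.
rewrite /= ltnS; case: c => [//|c] in ltc ltp bnd bndS *.
have ltc' := ltnW ltc; have := bnd _ ltc'.
rewrite doubleS /=; have [ltp' [b' [-> ->]]] := qp c ltc'.
rewrite ltp'; case: b'; rewrite ?mul1n ?mul0n ?addn0.
  have -> : p c < p c.+1 + h by lia.
  have -> : (p c + h < p c) = false by lia.
  by rewrite dbl // ltnW.
rewrite ltn_add2r; case: ltnP => [ltpp|lepp].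
  (* Here [q] may have two minima above [h], but then [p c < p c.+1], so the
     segment of length [c.+2] has one minimum of [p] more than [c.+1]. *)
  have -> : p c < p c + h by lia.
  by move: bndS; rewrite /= ltpp /= dbl // ltnW.
have -> : p c < p c.+1 + h by lia.
by rewrite dbl // ltnW.
Qed.

Lemma size_minima_digital k q a :
  digital k q -> a <= 2 ^ k -> size (minima q a (2 ^ k)) <= k.+1.
Proof.
elim: k q a => [|k IH] q a /=.
  move=> q0; case: a => [|[|//]] //= _.
  by rewrite q0.
move=> [p dp qp]; rewrite expnS mul2n => lea.
apply: (@size_minima_half (2 ^ k) p) => //.
  by move=> c ltc; split; [exact: digital_lt | exact: qp].
by move=> c; exact: IH.
Qed.

Lemma mem_minima_record n (q v : nat -> nat) a j :
  a <= n -> (forall x, x < n -> q x < n) ->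
  (forall x, x < n -> v (q x) = x) -> (forall t, q (v t) <= t) ->
  v j < a -> (forall i, i < j -> v i < a -> v i < v j) ->
  j \in minima q a n.
Proof.
move=> lean ltq qK vK ltv rec; have ltvn := leq_trans ltv lean.
(* An earlier slot with the same value would contradict the strict record at [j]. *)
have qv : q (v j) = j.
  apply/eqP; rewrite eqn_leq vK leqNgt; apply/negP => ltqj.
  by have := rec _ ltqj; rewrite qK // ltnn => /(_ ltv).
rewrite -qv; apply: mem_minima => // [|y /andP[lty ltya]]; first exact: ltq.
rewrite qv ltnNge; apply/negP; have ltyn := leq_trans ltya lean.
rewrite leq_eqVlt => /predU1P[eqj|ltj].
  by move: lty; rewrite -eqj qK // ltnn.
by have := rec _ ltj; rewrite qK // => /(_ ltya) /(ltn_trans lty); rewrite ltnn.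
Qed.
End Minima.

(** * Bit reversal and the first slot carrying a given value *)

Section Reversal.
Local Open Scope nat_scope.

Lemma bits_val_cons b s : bits_val (b :: s) = b * 2 ^ size s + bits_val s.
Proof.
elim/last_ind: s => [|s c IH]; first by case: b.
by rewrite -rcons_cons !bits_val_rcons IH size_rcons expnS; lia.
Qed.

Lemma bit_revS k x : x < 2 ^ k.+1 ->
  bit_rev k.+1 x%:Z = odd x * 2 ^ k + bit_rev k x./2%:Z :> nat.
Proof.
move=> ltx; rewrite /= !Defs.binE !modz_small /=; last 2 first.
- by rewrite expnS in ltx; lia.
- lia.
by rewrite mkseq_oddS rev_rcons bits_val_cons size_rev size_mkseq.
Qed.

Lemma bit_revK k x : bit_rev k (bit_rev k x%:Z)%:Z = x %% 2 ^ k :> nat.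
Proof.
rewrite /= (bin_bit_rev k x) revK.
by have := bits_val_bin k x; rewrite modz_nat => -[].
Qed.

Lemma bit_rev_small k x : x < 2 ^ k -> bit_rev k (bit_rev k x%:Z)%:Z = x :> nat.
Proof. by move=> ltx; rewrite bit_revK modn_small. Qed.

Lemma bit_rev_mod k x : bit_rev k (x %% 2 ^ k)%:Z = bit_rev k x%:Z :> nat.
Proof. by rewrite -bit_revK bit_rev_small. Qed.

(** Bit reversal is an involution below [2 ^ k], so [bit_rev k x] is the slot of [x] in a cycle; for
    [s < 2 ^ k], adding [2 ^ k - s] subtracts [s] modulo [2 ^ k] without truncation. *)
Definition slot (k s x : nat) : nat := (bit_rev k x%:Z + (2 ^ k - s)) %% 2 ^ k.

Lemma slot_lt k s x : slot k s x < 2 ^ k.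
Proof. by rewrite ltn_mod expn_gt0. Qed.

Lemma slotK k s x : s < 2 ^ k -> x < 2 ^ k ->
  bit_rev k (s + slot k s x)%:Z = x :> nat.
Proof.
move=> lts ltx; rewrite -bit_rev_mod modnDmr.
have -> : s + (bit_rev k x + (2 ^ k - s)) = bit_rev k x%:Z + 2 ^ k by lia.
by rewrite modnDr bit_rev_mod bit_rev_small.
Qed.

(** The broadcast is periodic, and [slot] picks the first occurrence, [t %% 2 ^ k]. *)
Lemma slot_bit_rev k s t : s < 2 ^ k -> slot k s (bit_rev k (s + t)%:Z) <= t.
Proof.
move=> lts; rewrite /slot bit_revK modnDml.
have -> : s + t + (2 ^ k - s) = t + 2 ^ k by lia.
by rewrite modnDr leq_mod.
Qed.

Lemma modn_double h y : 0 < h ->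
  exists b : bool, y %% h.*2 = y %% h + b * h /\
                   (h + y) %% h.*2 = y %% h + ~~ b * h.
Proof.
(* Adding [h] to [y] flips this parity. *)
move=> h0; exists (odd (y %/ h)).
have {1 4}-> : y = y %/ h %/ 2 * h.*2 + (odd (y %/ h) * h + y %% h).
  by rewrite {1}(divn_eq y h) {1}(divn_eq (y %/ h) 2) modn2; lia.
have ltr : y %% h < h by rewrite ltn_mod.
rewrite (addnCA h) !modnMDl; case: odd => /=.
  rewrite (@modn_small _ h.*2); last lia.
  have -> : h + (1 * h + y %% h) = h.*2 + y %% h by lia.
  by rewrite modnDl (@modn_small _ h.*2); lia.
by rewrite !(@modn_small _ h.*2); lia.
Qed.

(** The reversals of [c.*2] and [c.*2.+1] are [2 ^ k] apart, also after the shift. Keeping [m]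
    independent of [k] lets one shift serve all levels of the induction. *)
Lemma digital_bit_rev k m : digital k (fun x => (bit_rev k x%:Z + m) %% 2 ^ k).
Proof.
elim: k => [|k IH]; first by rewrite /= modn1.
exists (fun x => (bit_rev k x%:Z + m) %% 2 ^ k) => // c ltc.
rewrite !bit_revS; [|rewrite expnS; lia ..].
rewrite oddS odd_double -[c.*2.+1]/(true + c.*2) half_bit_double doubleK.
rewrite mul1n mul0n add0n expnS mul2n -addnA.
by apply: modn_double; rewrite expn_gt0.
Qed.
End Reversal.

(** * Bounding a counting measure by a covering list *)

Section Counting.
Local Open Scope classical_set_scope.
Local Open Scope ring_scope.

Lemma counting_le_size (R : realType) (T : choiceType) (X : set T) (s : seq T) m :
  X `<=` [set` s] -> (size s <= m)%N -> (counting X <= m%:R%:E :> \bar R)%E.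
Proof.
move=> Xs szs; have finX : finite_set X by apply: sub_finite_set Xs _; exact: finite_seq.
rewrite /counting asboolT // lee_fin ler_nat (leq_trans _ szs) //.
apply: uniq_leq_size => // x; rewrite in_fset_set // inE.
exact: Xs.
Qed.
End Counting.

Lemma down_closed_ord (n : nat) (P : pred 'I_n) :
  (forall i j : 'I_n, (i <= j)%N -> P j -> P i) ->
  exists2 a, (a <= n)%N & forall i, P i = (i < a)%N.
Proof.
(* The successor distinguishes an empty [P], with cut 0, from one holding at index 0 only. *)
move=> closed; exists (\max_(i | P i) i.+1)%N; first by apply/bigmax_leqP => i _.
move=> i; apply/idP/idP => [Pi|]; first exact: (@leq_bigmax_cond _ P (fun i => i.+1)).
apply: contraTT => nPi; rewrite -leqNgt; apply/bigmax_leqP => j Pj.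
by rewrite ltnNge; apply: contra nPi => /closed; apply.
Qed.

(** * Changes of [lb] and [ub] during a run *)

Section Receiver.
Variables (R : realType) (k : nat) (key : 'I_(2 ^ k) -> R).
Hypothesis key_sorted : forall i j : 'I_(2 ^ k), (i <= j)%N -> (key i <= key j)%R.
Variables (kmin kmax : R).
Hypothesis kmin_le_kmax : (kmin <= kmax)%R.
Variable s : nat.
Hypothesis s_lt : (s < 2 ^ k)%N.
Local Open Scope ring_scope.

Definition heard (j : nat) : 'I_(2 ^ k) := bit_rev k (s + j)%N%:Z.
Local Notation v := heard.
Local Notation run := (run key kmin kmax s).

Lemma lb_runS j : lb (run j.+1) =
  if [&& lb (run j) <= (v j : nat)%:Z, (v j : nat)%:Z <= ub (run j)
       & key (v j) < kmin] then (v j : nat)%:Z + 1 else lb (run j).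
Proof. by rewrite andbA /= /receive; case: ifP. Qed.

Lemma ub_runS j : ub (run j.+1) =
  if [&& lb (run j) <= (v j : nat)%:Z, (v j : nat)%:Z <= ub (run j)
       & kmax < key (v j)] then (v j : nat)%:Z - 1 else ub (run j).
Proof. by rewrite andbA /= /receive; case: ifP. Qed.

Lemma lb_le j (x : 'I_(2 ^ k)) : kmin <= key x -> lb (run j) <= (x : nat)%:Z.
Proof.
move=> lex; elim: j => [//|j IH]; rewrite lb_runS; case: ifP => // /and3P[_ _ ltk].
suff : (v j < x)%N by lia.
rewrite ltnNge; apply/negP => /key_sorted lexv.
by move: (le_lt_trans (le_trans lex lexv) ltk); rewrite ltxx.
Qed.

Lemma ub_ge j (x : 'I_(2 ^ k)) : key x <= kmax -> (x : nat)%:Z <= ub (run j).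
Proof.
move=> lex; elim: j => [|j IH]; first by have := ltn_ord x; rewrite /=; lia.
rewrite ub_runS; case: ifP => // /and3P[_ _ ltk].
suff : (x < v j)%N by lia.
rewrite ltnNge; apply/negP => /key_sorted lexv.
by move: (lt_le_trans ltk (le_trans lexv lex)); rewrite ltxx.
Qed.

Lemma lb_gt i j : (i < j)%N -> key (v i) < kmin -> (v i : nat)%:Z < lb (run j).
Proof.
move=> ltij ltk; elim: j ltij => [//|j IH]; rewrite ltnS leq_eqVlt lb_runS.
case/predU1P => [<-|/IH {}IH]; last by case: ifP => // /and3P[]; lia.
(* Since [kmin <= kmax], the right end never hides a key below [kmin]; only [lb] matters. *)
have -> : (v i : nat)%:Z <= ub (run i).
  exact/ub_ge/ltW/(lt_le_trans ltk).
by rewrite ltk andbT; case: ifP; lia.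
Qed.

Lemma ub_lt i j : (i < j)%N -> kmax < key (v i) -> ub (run j) < (v i : nat)%:Z.
Proof.
move=> ltij ltk; elim: j ltij => [//|j IH]; rewrite ltnS leq_eqVlt ub_runS.
case/predU1P => [<-|/IH {}IH]; last by case: ifP => // /and3P[]; lia.
have -> : lb (run i) <= (v i : nat)%:Z.
  exact/lb_le/ltW/(le_lt_trans _ ltk).
by rewrite ltk andbT; case: ifP => /=; lia.
Qed.

(** At a change, [lb] is at most the current index but already exceeds every earlier broadcast index
    below [a], so the current one is a record. *)
Lemma left_energy_le : (left_energy key kmin kmax s <= k.+1%:R%:E)%E.
Proof.
have [|a lea keya] := @down_closed_ord _ (fun i => key i < kmin).
  by move=> i j /key_sorted leij; apply: le_lt_trans.
apply: (@counting_le_size _ _ _ (minima (slot k s) a (2 ^ k)%N)); last first.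
  by apply: size_minima_digital => //; apply: digital_bit_rev.
move=> j; rewrite /mkset lb_runS; case: ifP => // /and3P[lb_v ub_v ltk] _.
apply: (@mem_minima_record _ _ (fun t => v t : nat)) => //.
- by move=> x _; apply: slot_lt.
- by move=> x ltx; apply: slotK.
- by move=> t; apply: slot_bit_rev.
- by rewrite -keya.
- by move=> i ltij; rewrite -keya => /(lb_gt ltij); rewrite -ltz_nat => /lt_le_trans; apply.
Qed.

Lemma right_energy_le : (right_energy key kmin kmax s <= k.+1%:R%:E)%E.
Proof.
(* Reflecting the indices turns the keys above [kmax] into an initial segment. *)
have [|a lea keya] := @down_closed_ord _ (fun i => kmax < key (rev_ord i)).
  move=> i j leij ltk; apply: (lt_le_trans ltk); apply: key_sorted => /=.
  by rewrite leq_sub2l.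
pose q x := slot k s (2 ^ k - x.+1)%N.
apply: (@counting_le_size _ _ _ (minima q a (2 ^ k)%N)); last first.
  by apply: size_minima_digital => //; apply/digital_opp/digital_bit_rev.
have gt_v i : (kmax < key (v i)) = (rev_ord (v i) < a)%N.
  by rewrite -keya rev_ordK.
move=> j; rewrite /mkset ub_runS; case: ifP => // /and3P[lb_v ub_v ltk] _.
apply: (@mem_minima_record _ _ (fun t => rev_ord (v t) : nat)) => //.
- by move=> x _; apply: slot_lt.
- move=> x ltx; rewrite [LHS]/(2 ^ k - (v _ : nat).+1)%N slotK //; lia.
- move=> t; rewrite /q [rev_ord _ : nat]/(2 ^ k - (v t : nat).+1)%N.
  by rewrite subnSK // subKn; [exact: slot_bit_rev | exact: ltnW].
- by rewrite -gt_v.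
- move=> i ltij; rewrite -gt_v => /(ub_lt ltij) ltub.
  have ltv : (v j < v i)%N by rewrite -ltz_nat (le_lt_trans ub_v).
  by apply: ltn_sub2l; rewrite // (leq_ltn_trans ltv).
Qed.
End Receiver.

Local Open Scope ring_scope.

Theorem theorem1 (R : realType) (k : nat) (key : 'I_(2 ^ k) -> R)
    (key_sorted : forall i j : 'I_(2 ^ k), (i <= j)%N -> key i <= key j)
    (kmin kmax : R) (kmin_le_kmax : kmin <= kmax)
    (s : nat) (s_lt : (s < 2 ^ k)%N) :
  (extra_energy key kmin kmax s <= (2 * k + 3)%:R%:E)%E.
Proof.
apply: (@le_trans _ _ (k.+1%:R%:E + k.+1%:R%:E)%E).
  by apply: leeD; [exact: left_energy_le | exact: right_energy_le].
(* The two sides add up to [2 * k + 2], one less than the bound claimed. *)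
by rewrite -EFinD lee_fin -natrD ler_nat; lia.
Qed.
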